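(* Under the Qualification assumption, there exists a solution $(m,\pi,u,\gamma,P)\in\mathcal R\times\mathcal K$ to the mean field game system (MFG): for all $(t,s,x)\in\mathcal T\times\bar{\mathcal T}\times S$, (i) $u(t,x)=\inf_{\rho\in\Delta(S)}\big[\ell(t,x,\rho)+\gamma(t,x)+\sum_{y\in S}\rho(y)(\alpha(t,x,y)P(t)+u(t+1,y))\big]$, $u(T,x)=\gamma(T,x)$; (ii) $\pi(t,x,\cdot)\in\Delta(S)$ attains the infimum in (i); (iii) $m(t+1,x)=\sum_{y\in S}m(t,y)\pi(t,y,x)$, $m(0,x)=m_0(x)$; (iv) $\gamma(s,\cdot)\in\partial F(s,m(s,\cdot))$; (v) $P(t)\in\partial\phi\big(t,\sum_{(x,y)\in S^2}m(t,x)\pi(t,x,y)\alpha(t,x,y)\big)$.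
   Context: Let $T\ge 1$, $n\ge 1$ be integers, $\mathcal T=\{0,\dots,T-1\}$, $\bar{\mathcal T}=\{0,\dots,T\}$, $S=\{0,\dots,n-1\}$. For a finite set $A$, $\mathbb R(A)$ is the space of functions $A\to\mathbb R$ (Euclidean inner product and norm). $\Delta(S)=\{\rho:S\to[0,1]:\sum_{x}\rho(x)=1\}$. Spaces: $\mathcal R=\mathbb R(\bar{\mathcal T}\times S)\times\mathbb R(\mathcal T\times S^2)$, $\mathcal K=\mathbb R(\bar{\mathcal T}\times S)\times\mathbb R(\bar{\mathcal T}\times S)\times\mathbb R(\mathcal T)$. Data: $m_0\in\Delta(S)$, $\alpha:\mathcal T\times S^2\to\mathbb R$, $\ell:\mathcal T\times S\times\mathbb R(S)\to\mathbb R\cup\{+\infty\}$, $\phi:\mathcal T\times\mathbb R\to\mathbb R\cup\{+\infty\}$, $F:\bar{\mathcal T}\times\mathbb R(S)\to\mathbb R\cup\{+\infty\}$. Standing assumption: for all $(t,s,x)\in\mathcal T\times\bar{\mathcal T}\times S$ the functions $\ell(t,x,\cdot)$, $F(s,\cdot)$, $\phi(t,\cdot)$ are proper, convex and lower semicontinuous, and $\mathrm{dom}(\ell(t,x,\cdot))\subseteq\Delta(S)$. Subdifferentials $\partial F(s,\cdot)$, $\partial\phi(t,\cdot)$ are convex subdifferentials in the last variable (empty where the function is $+\infty$). Qualification assumption: there exists $\alpha_0>0$ such that for every $\varepsilon=(\varepsilon_1,\varepsilon_2,\varepsilon_3)\in\mathcal K$ with $\|\varepsilon\|\le\alpha_0$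 there exists $\pi:\mathcal T\times S\times S\to\mathbb R$ with $\pi(t,x,\cdot)\in\mathrm{dom}(\ell(t,x,\cdot))$ for all $(t,x)$ such that $m_1[\varepsilon,\pi]\ge0$, $m_2[\varepsilon,\pi](s,\cdot)\in\mathrm{dom}(F(s,\cdot))$ for all $s\in\bar{\mathcal T}$, and $D[\varepsilon,\pi](t)\in\mathrm{dom}(\phi(t,\cdot))$ for all $t\in\mathcal T$. Here $m_1=m_1[\varepsilon,\pi]$ solves $m_1(0,x)-\varepsilon_1(0,x)=m_0(x)$, $m_1(t+1,x)=\sum_{y\in S}m_1(t,y)\pi(t,y,x)-\varepsilon_1(t+1,x)$; $m_2[\varepsilon,\pi]=m_1[\varepsilon,\pi]+\varepsilon_2$; $D[\varepsilon,\pi](t)=\sum_{(x,y)\in S^2}m_1[\varepsilon,\pi](t,x)\pi(t,x,y)\alpha(t,x,y)+\varepsilon_3(t)$. *)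

(* Defs.v *)
From HB Require Import structures.
From mathcomp Require Import all_boot all_order all_algebra.
From mathcomp Require Import all_classical all_reals.
From mathcomp Require Import ereal topology normedtype.
Set Implicit Arguments.
Unset Strict Implicit.
Unset Printing Implicit Defensive.
Import Order.TTheory GRing.Theory Num.Theory.
Import numFieldNormedType.Exports.
Local Open Scope classical_set_scope.
Local Open Scope ring_scope.

(* Conventions. S = 'I_n, the set of decision times {0, .., T-1} is 'I_T and
   {0, .., T} is 'I_T.+1.  R(S) = 'rV[R]_n, R({0..T} x S) = 'M[R]_(T.+1, n),
   R({0..T-1} x S^2) = 'I_T -> 'M[R]_n and R({0..T-1}) = 'rV[R]_T; thus
   m(s, .) is row s m and pi(t, x, .) is row x (pi t). *)

(* t and t + 1, for t < T, as elements of {0, .., T} *)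
Definition now (T : nat) (t : 'I_T) : 'I_T.+1 := widen_ord (leqnSn T) t.
Definition next (T : nat) (t : 'I_T) : 'I_T.+1 := lift ord0 t.

Section ConvexAnalysis.
Context {R : realType}.
Local Open Scope ereal_scope.

Definition effective_domain (V : Type) (f : V -> \bar R) : set V :=
  [set v | f v < +oo].

(* This includes the requirement that f takes its values in R U {+oo}. *)
Definition proper (V : Type) (f : V -> \bar R) : Prop :=
  (forall v, f v != -oo) /\ (exists v, f v < +oo).

(* The library's convex_function is for real-valued functions.  At the
   endpoints a = 0 and a = 1, the convention 0 * +oo = 0 makes the inequality
   trivially true. *)
Definition convex_ereal (V : lmodType R) (f : V -> \bar R) : Prop :=
  forall (v w : V) (a : R), (0 <= a <= 1)%R ->
    f (a *: v + (1 - a) *: w)%R <= a%:E * f v + (1 - a)%:E * f w.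

(* Convex subdifferential of f at v, with respect to the inner product dot;
   empty where f is not finite. *)
Definition subdifferential (V : zmodType) (dot : V -> V -> R)
    (f : V -> \bar R) (v : V) : set V :=
  [set p | f v \is a fin_num /\
           forall w, f v + (dot p (w - v)%R)%:E <= f w].

End ConvexAnalysis.

Section MeanFieldGame.
Context {R : realType} {T n : nat}.

Definition dot (u v : 'rV[R]_n) : R := \sum_(x < n) u 0 x * v 0 x.

Definition simplex : set 'rV[R]_n :=
  [set rho | (forall x, 0 <= rho 0 x <= 1) /\ \sum_(x < n) rho 0 x = 1].

Definition enormK (eps1 eps2 : 'M[R]_(T.+1, n)) (eps3 : 'rV[R]_T) : R :=
  Num.sqrt (\sum_(s < T.+1) \sum_(x < n) eps1 s x ^+ 2 +
            \sum_(s < T.+1) \sum_(x < n) eps2 s x ^+ 2 +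
            \sum_(t < T) eps3 0 t ^+ 2).

Definition standing_assumption
    (ell : 'I_T -> 'I_n -> 'rV[R]_n -> \bar R)
    (phi : 'I_T -> R^o -> \bar R)
    (F : 'I_T.+1 -> 'rV[R]_n -> \bar R) : Prop :=
  [/\ forall t x, [/\ proper (ell t x), convex_ereal (ell t x),
                      lower_semicontinuous (ell t x) &
                      effective_domain (ell t x) `<=` simplex],
      forall s, [/\ proper (F s), convex_ereal (F s) &
                    lower_semicontinuous (F s)] &
      forall t, [/\ proper (phi t), convex_ereal (phi t) &
                    lower_semicontinuous (phi t)]].

(* m1 = m_1[eps, pi]; only the first component eps1 of eps intervenes. *)
Definition perturbed_flow (m0 : 'rV[R]_n) (eps1 : 'M[R]_(T.+1, n))
    (pi : 'I_T -> 'M[R]_n) (m1 : 'M[R]_(T.+1, n)) : Prop :=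
  (forall x, m1 ord0 x - eps1 ord0 x = m0 0 x) /\
  (forall t x, m1 (next t) x =
     \sum_(y < n) m1 (now t) y * pi t y x - eps1 (next t) x).

(* The recursion determines m1, so quantifying over m1 below is harmless. *)
Lemma perturbed_flow_exists_unique m0 eps1 pi :
  exists! m1, perturbed_flow m0 eps1 pi m1.
Proof.
pose step k (v : 'I_n -> R) (x : 'I_n) : R :=
  if insub k is Some t
  then \sum_(y < n) v y * pi t y x - eps1 (next t) x else 0.
pose fix flow k : 'I_n -> R :=
  if k is k'.+1 then step k' (flow k') else fun x => m0 0 x + eps1 ord0 x.
exists (\matrix_(s, x) flow s x); split.
  split=> [x|t x]; first by rewrite !mxE /= addrK.
  rewrite mxE /= /step valK; congr (_ - _).
  by apply: eq_bigr => y _; rewrite mxE.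
move=> m1 [h0 hS]; apply/matrixP => -[k hk] x; rewrite mxE /=.
elim: k hk x => [|k IH] hk x /=.
  rewrite -h0 subrK; congr (m1 _ x); exact: val_inj.
have kT : (k < T)%N by [].
rewrite /step insubT.
have -> : Ordinal hk = next (Ordinal kT) by exact: val_inj.
rewrite hS (_ : Sub k kT = Ordinal kT) //; congr (_ - _).
apply: eq_bigr => y _; rewrite (IH (ltnW hk)); congr (m1 _ y * _).
exact: val_inj.
Qed.

Definition aggregate (alpha : 'I_T -> 'M[R]_n) (m : 'M[R]_(T.+1, n))
    (pi : 'I_T -> 'M[R]_n) (t : 'I_T) : R :=
  \sum_(x < n) \sum_(y < n) m (now t) x * pi t x y * alpha t x y.

Definition qualification (m0 : 'rV[R]_n) (alpha : 'I_T -> 'M[R]_n)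
    (ell : 'I_T -> 'I_n -> 'rV[R]_n -> \bar R)
    (phi : 'I_T -> R^o -> \bar R)
    (F : 'I_T.+1 -> 'rV[R]_n -> \bar R) : Prop :=
  exists2 alpha0 : R, 0 < alpha0 &
  forall (eps1 eps2 : 'M[R]_(T.+1, n)) (eps3 : 'rV[R]_T),
    enormK eps1 eps2 eps3 <= alpha0 ->
  exists (pi : 'I_T -> 'M[R]_n) (m1 : 'M[R]_(T.+1, n)),
    (forall t x, effective_domain (ell t x) (row x (pi t))) /\
    [/\ perturbed_flow m0 eps1 pi m1,
        forall s x, 0 <= m1 s x,
        forall s, effective_domain (F s) (row s (m1 + eps2)) &
        forall t, effective_domain (phi t)
                    (aggregate alpha m1 pi t + eps3 0 t)].

Definition cost (alpha : 'I_T -> 'M[R]_n)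
    (ell : 'I_T -> 'I_n -> 'rV[R]_n -> \bar R)
    (u gamma : 'M[R]_(T.+1, n)) (P : 'rV[R]_T)
    (t : 'I_T) (x : 'I_n) (rho : 'rV[R]_n) : \bar R :=
  (ell t x rho + (gamma (now t) x)%:E +
   (\sum_(y < n) rho 0 y * (alpha t x y * P 0 t + u (next t) y))%R%:E)%E.

Definition MFG_solution (m0 : 'rV[R]_n) (alpha : 'I_T -> 'M[R]_n)
    (ell : 'I_T -> 'I_n -> 'rV[R]_n -> \bar R)
    (phi : 'I_T -> R^o -> \bar R)
    (F : 'I_T.+1 -> 'rV[R]_n -> \bar R)
    (m : 'M[R]_(T.+1, n)) (pi : 'I_T -> 'M[R]_n)
    (u gamma : 'M[R]_(T.+1, n)) (P : 'rV[R]_T) : Prop :=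
  [/\ (forall t x, (u (now t) x)%:E =
         ereal_inf [set cost alpha ell u gamma P t x rho | rho in simplex]) /\
      (forall x, u ord_max x = gamma ord_max x),
      forall t x, simplex (row x (pi t)) /\
        cost alpha ell u gamma P t x (row x (pi t)) =
          ereal_inf [set cost alpha ell u gamma P t x rho | rho in simplex],
      (forall t x, m (next t) x = \sum_(y < n) m (now t) y * pi t y x) /\
      (forall x, m ord0 x = m0 0 x),
      forall s, subdifferential dot (F s) (row s m) (row s gamma) &
      forall t, subdifferential ( *%R : R^o -> R^o -> R) (phi t)
                  (aggregate alpha m pi t) (P 0 t)].

End MeanFieldGame.

(* Main.v *)
From Pilot Require Import Defs.
From HB Require Import structures.
From mathcomp Require Import all_boot all_order all_algebra.
From mathcomp Require Import all_classical all_reals.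
From mathcomp Require Import ereal topology normedtype.
From mathcomp Require Import ring lra.
Set Implicit Arguments.
Unset Strict Implicit.
Unset Printing Implicit Defensive.
Import Order.TTheory GRing.Theory Num.Theory.
Import numFieldNormedType.Exports.
Local Open Scope classical_set_scope.
Local Open Scope ring_scope.
(* [next] has been hidden by the function of that name on cyclic sequences. *)
Import Pilot.Defs.

(** The system is the optimality system of a convex problem: among the admissible
    pairs (state m, policy pi), minimise
      sum_(t,x) m(t,x) ell(t, x, pi(t,x)) + sum_s F(s, m(s)) + sum_t phi(t, D(t)),
    where D(t) is the aggregate. The product m ell(pi) is read with 0 * +oo = 0.

    Convexity. The problem is not convex in (m, pi), but it is convex in (m, m pi):
    two policies are mixed at each state in proportion to the masses that their
    flows have there, and the cost of the mixture is controlled by the convexity of the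
    perspective function of ell ([mix_admissible]). Hence the set of pairs
    (eps, r) such that r bounds the cost of some policy, when m is replaced with
    m + eps.1 in F and D with D + eps.2 in phi, is convex ([attainable_convex]).

    Existence. The pairs (m, pi) form a compact set, and the total cost is lower
    semicontinuous, including at the points where m(t,x) = 0 and ell is infinite,
    because ell is bounded below ([lsc_weighted]). So the unperturbed problem has a
    minimiser ([attainable_minimum]).

    Multipliers. The qualification makes the value function finite in some
    positive multiple of every direction, so that it has a subgradient
    (gamma, P) at 0 ([subgradient_exists]). Perturbing a single term gives
    gamma(s) in the subdifferential of F(s) and P(t) in that of phi(t); perturbing
    all the terms at once shows that (m, pi) also minimises the cost in which F and
    phi are replaced with the linear prices gamma and P ([multipliers_exist]).

    Dynamic programming. The linearised problem is a Markov decision problem. Let u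
    solve its Bellman equation by backward recursion ([bellman_exists]).
    Telescoping m(t) u(t) along the flow writes the linearised cost of any policy
    as m0 u(0) plus the sum of m(t,x) times the nonnegative Bellman gap
    of pi(t,x) ([telescoped_value]). A Bellman-optimal policy has no gap, so the
    minimiser has none wherever m(t,x) > 0. Where m(t,x) = 0 the policy can be
    replaced with a Bellman-optimal one without changing the flow or the
    aggregate. *)

(** * Subgradients of convex functions given by their epigraph *)

(** [G v r] is read as: [r] is an upper bound of the value at [v] of some function.
    Working with such an epigraph instead of the function expresses convexity and
    finiteness without extended-real arithmetic. *)
Definition convex_rel {R : realType} {V : lmodType R} (G : V -> R -> Prop) : Prop :=
  forall v w r s a, 0 <= a <= 1 -> G v r -> G w s ->
    G (a *: v + (1 - a) *: w) (a * r + (1 - a) * s).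

(** The algebraic form of: 0 is interior to the domain. *)
Definition absorbing_rel {R : realType} {V : lmodType R} (G : V -> R -> Prop) : Prop :=
  forall d, exists2 a, 0 < a & exists r, G (a *: d) r.

(** On a line through 0, the difference quotients at positive parameters all dominate
    those at negative parameters, since otherwise a chord would pass below
    [r0] at 0. The infimum of the former is therefore a slope that
    works on both sides; absorption in the directions [e] and [- e] makes it finite. *)
Lemma directional_slope {R : realType} {V : lmodType R} (G : V -> R -> Prop)
    (r0 : R) (e : V) :
  convex_rel G -> absorbing_rel G -> (forall r, G 0 r -> r0 <= r) ->
  exists c, forall t r, G (t *: e) r -> r0 + t * c <= r.
Proof.
move=> Gconv Gabs G0.
have chord t s r r' : 0 < t -> 0 < s -> G (t *: e) r -> G (- s *: e) r' ->
    - ((r' - r0) / s) <= (r - r0) / t.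
  move=> t0 s0 Gr Gr'.
  (* s / (t + s) is the weight of [t *: e] for which the combination with
     [- s *: e] vanishes. *)
  have ts0 : 0 < t + s by lra.
  have a01 : 0 <= s / (t + s) <= 1.
    apply/andP; split; first by rewrite divr_ge0 ?ltW.
    by rewrite ler_pdivrMr // mul1r; lra.
  have := Gconv _ _ _ _ _ a01 Gr Gr'.
  have -> : 1 - s / (t + s) = t / (t + s) by field; lra.
  have e0 : s / (t + s) * t + t / (t + s) * - s = 0 by field; lra.
  rewrite !scalerA -scalerDl e0 scale0r.
  move=> /G0; rewrite -(ler_pM2r ts0) => h.
  have e1 : (s / (t + s) * r + t / (t + s) * r') * (t + s) = s * r + t * r'.
    by field; lra.
  rewrite e1 in h; rewrite -mulNr ler_pdivrMr // mulrAC ler_pdivlMr //.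
  lra.
pose A := [set q | exists2 t, 0 < t & exists2 r, G (t *: e) r & q = (r - r0) / t].
have [tp tp0 [rp Grp]] := Gabs e.
have [tm tm0 [rm Grm]] := Gabs (- e).
have {}Grm : G (- tm *: e) rm by rewrite scaleNr -scalerN.
have Alb s r' : 0 < s -> G (- s *: e) r' -> lbound A (- ((r' - r0) / s)).
  by move=> s0 Gr' _ [t t0 [r Gr ->]]; exact: chord.
have Ah : has_lbound A by exists (- ((rm - r0) / tm)); exact: Alb.
exists (inf A) => t r Gr.
have [t0|t0|t0] := ltrgt0P t; last first.
- by rewrite t0 mul0r addr0; apply: G0; rewrite -(scale0r e) -t0.
- have s0 : 0 < - t by rewrite oppr_gt0.
  have : - ((r - r0) / - t) <= inf A.
    apply: lb_le_inf; first by exists ((rp - r0) / tp), tp => //; exists rp.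
    by apply: Alb => //; rewrite opprK.
  by rewrite invrN mulrN opprK ler_ndivrMr //; nra.
- have : inf A <= (r - r0) / t by apply: ge_inf => //; exists t => //; exists r.
  by rewrite ler_pdivlMr //; nra.
Qed.

(** Finite-dimensional Hahn-Banach, one direction at a time. Once a slope [c0] is
    chosen along the first direction, the set is replaced with its saturation by the
    line spanned by (e 0, c0): this is again convex and absorbing, the
    choice of [c0] keeps it above [r0] at 0, and the other directions follow by
    induction. *)
Lemma family_subgradient {R : realType} {V : lmodType R} k (e : 'I_k -> V)
    (G : V -> R -> Prop) (r0 : R) :
  convex_rel G -> absorbing_rel G -> (forall r, G 0 r -> r0 <= r) ->
  exists c : 'I_k -> R, forall t r,
    G (\sum_(i < k) t i *: e i) r -> r0 + \sum_(i < k) t i * c i <= r.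
Proof.
elim: k e G => [|k IH] e G Gconv Gabs G0.
  exists (fun=> 0) => t r; rewrite !big_ord0 addr0; exact: G0.
have [c0 c0P] := directional_slope (e ord0) Gconv Gabs G0.
pose G' v r := exists t, G (v + t *: e ord0) (r + t * c0).
have [||r [t]|c cP] := IH (fun i => e (lift ord0 i)) G'.
- move=> v w r s a a01 [t Gv] [t' Gw]; exists (a * t + (1 - a) * t').
  rewrite [X in _ + X]scalerDl -!scalerA addrACA -!scalerDr.
  have -> : a * r + (1 - a) * s + (a * t + (1 - a) * t') * c0 =
      a * (r + t * c0) + (1 - a) * (s + t' * c0) by ring.
  exact: Gconv.
- move=> d; have [a a0 [r Gr]] := Gabs d; exists a => //; exists r, 0.
  by rewrite scale0r mul0r !addr0.
- by rewrite add0r => /c0P; rewrite lerD2r.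
exists (fun i => oapp c c0 (unlift ord0 i)) => t r.
rewrite !big_ord_recl unlift_none /= => Gr.
under eq_bigr do rewrite liftK /=.
have /cP : G' (\sum_(i < k) t (lift ord0 i) *: e (lift ord0 i)) (r - t ord0 * c0).
  by exists (t ord0); rewrite addrC subrK.
lra.
Qed.

Lemma subgradient_exists {R : realType} {V : vectType R} (G : V -> R -> Prop) (r0 : R) :
  convex_rel G -> absorbing_rel G -> (forall r, G 0 r -> r0 <= r) ->
  exists f : {linear V -> R^o}, forall v r, G v r -> r0 + f v <= r.
Proof.
move=> Gconv Gabs G0; pose b := vbasis (@fullv R V).
have [c cP] := family_subgradient (fun i : 'I_(\dim (@fullv R V)) => b`_i) Gconv Gabs G0.
pose f (v : V) : R^o := \sum_i coord b i v * c i.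
have flin : linear f.
  move=> a v w; rewrite /f scaler_sumr -big_split; apply: eq_bigr => i _ /=.
  by rewrite linearP mulrDl; congr (_ + _); exact: esym (mulrA _ _ _).
pose fM := GRing.isLinear.Build R V R^o *:%R f flin.
pose fL : {linear V -> R^o} := HB.pack f fM.
exists fL => v r Gv; apply: cP; rewrite -coord_vbasis ?memvf //.
Qed.

(** * Sums and products of extended reals *)

Lemma mule_neqNy {R : realType} (b : R) (y : \bar R) :
  0 <= b -> y != -oo%E -> (b%:E * y)%E != -oo%E.
Proof.
move=> b0; case: y => [r||] // _.
by case: ltrgtP b0 => // [b0 _|<- _]; rewrite ?mul0e // mulry gtr0_sg // mul1e.
Qed.

Lemma adde_lty {R : realType} (x y : \bar R) : x != -oo%E -> y != -oo%E ->
  (x + y < +oo -> x < +oo /\ y < +oo)%E.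
Proof. by case: x y => [x||] [y||] //= _ _ _; rewrite ?ltry. Qed.

Lemma sume_lty {R : realType} (I : finType) (f : I -> \bar R) :
  (forall i, f i != -oo%E) -> (\sum_i f i < +oo)%E -> forall i, (f i < +oo)%E.
Proof.
move=> fNy sfin i; rewrite ltNge leye_eq; apply/negP => /eqP fi.
by move: sfin; rewrite (_ : (\sum_i f i)%E = +oo%E) //; apply/esum_eqyP => //; exists i.
Qed.

Lemma sume_neqNy {R : realType} (I : finType) (f : I -> \bar R) :
  (forall i, f i != -oo%E) -> (\sum_i f i)%E != -oo%E.
Proof. by move=> fNy; apply/eqP => /esum_eqNyP[i [_ _ /eqP]]; exact/negP. Qed.

Lemma lee_conv {R : realType} (a u v : R) (x y : \bar R) : 0 <= a <= 1 ->
  (x <= u%:E -> y <= v%:E -> a%:E * x + (1 - a)%:E * y <= (a * u + (1 - a) * v)%:E)%E.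
Proof.
move=> /andP[a0 a1] xu yv; rewrite [leRHS]EFinD !EFinM.
by apply: leeD; apply: lee_wpmul2l; rewrite ?lee_fin ?subr_ge0.
Qed.

(** * Lower semicontinuity and compactness *)

Lemma continuous_add {R : realType} {X : topologicalType} (f g : X -> R) :
  continuous f -> continuous g -> continuous (fun x => f x + g x).
Proof. by move=> fc gc x; apply: cvgD; [exact: fc|exact: gc]. Qed.

Lemma continuous_mul {R : realType} {X : topologicalType} (f g : X -> R) :
  continuous f -> continuous g -> continuous (fun x => f x * g x).
Proof. by move=> fc gc x; apply: cvgM; [exact: fc|exact: gc]. Qed.

Lemma continuous_sum {R : realType} {X : topologicalType} (I : Type) (r : seq I)
    (f : I -> X -> R) :
  (forall i, continuous (f i)) -> continuous (fun x => \sum_(i <- r) f i x).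
Proof. by move=> fc; apply: continuous_big => //; exact: add_continuous. Qed.

Lemma continuous_rV {R : realType} {X : topologicalType} (n : nat) (f : X -> 'rV[R]_n) :
  (forall j, continuous (fun x => f x 0 j)) -> continuous f.
Proof.
move=> fc x A [P Pfx PA].
have : \forall y \near x, forall i j, P i j (f y i j).
  apply: filter_forall => i; apply: filter_forall => j.
  by rewrite ord1; apply: fc; rewrite -(ord1 i).
by apply: filterS => y; exact: PA.
Qed.

Lemma closed_equations {R : realType} {X : topologicalType} (I : Type)
    (f g : I -> X -> R) :
  (forall i, continuous (f i)) -> (forall i, continuous (g i)) ->
  closed [set x | forall i, f i x = g i x].
Proof.
move=> fc gc; have -> : [set x | forall i, f i x = g i x] =
    \bigcap_(i in [set: I]) [set x | f i x - g i x = 0].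
  apply/seteqP; split=> x /= fg i; first by move=> _ /=; rewrite fg subrr.
  by apply/eqP; rewrite -subr_eq0; apply/eqP; exact: fg.
apply: closed_bigI => i _.
apply: (@preimage_closed _ _ (fun x => f i x - g i x) [set y | y = 0]) => [x _|].
  by apply: cvgB; [exact: fc|exact: gc].
exact: closed_eq.
Qed.

(** The sublevel sets at points of [K] form a filter base, as they are totally ordered.
    If no point were minimal, every point of [K] would have a neighbourhood on which
    [f] exceeds some attained value; covering [K] would then yield a point at which
    [f] exceeds its own value. *)
Lemma lsc_compact_min {R : realType} {X : topologicalType} (K : set X)
    (f : X -> \bar R) :
  compact K -> K !=set0 -> lower_semicontinuous f ->
  exists2 x, K x & forall y, K y -> (f x <= f y)%E.
Proof.
move=> Kc [k0 Kk0] lf; apply: contrapT => nomin.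
have lower x : K x -> exists2 y, K y & (f y < f x)%E.
  move=> Kx; apply: contrapT => hx; apply: nomin; exists x => // y Ky.
  by rewrite leNgt; apply/negP => fyx; apply: hx; exists y.
pose B y := [set z | K z /\ (f z <= f y)%E].
have FF : Filter (filter_from K B).
  apply: filter_from_filter; first by exists k0.
  move=> y z Ky Kz; have [fyz|/ltW fzy] := leP (f y) (f z).
    exists y => // w [Kw wy]; split; split => //; exact: le_trans fyz.
  by exists z => // w [Kw wy]; split; split => //; exact: le_trans fzy.
have /compact_near_coveringP/(_ _ _ (fun z x => (f z < f x)%E) FF) := Kc.
case=> [x Kx|y Ky KB].
  have [y Ky fyx] := lower x Kx.
  have [a fya afx] : exists2 a, (f y <= a%:E)%E & (a%:E < f x)%E.
    move: fyx; case: (f y) => [b||] //; case: (f x) => [c||] //= bc.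
    - by exists b.
    - by exists b => //; rewrite ltry.
    - by exists (c - 1); rewrite ?leNye // lte_fin ltrBlDr ltrDl.
    - by exists 0; rewrite ?leNye ?ltry.
  have [W xW Wa] := lf _ _ afx.
  exists (W, B y); first by split=> //; exists y.
  move=> [x' z] /= [Wx' [Kz fzy]].
  exact: le_lt_trans (le_trans fzy fya) (Wa _ Wx').
by have := KB y (conj Ky (lexx _)) y Ky; rewrite ltxx.
Qed.

Lemma lsc_comp {R : realType} {X Y : topologicalType} (f : Y -> \bar R) (g : X -> Y) :
  continuous g -> lower_semicontinuous f -> lower_semicontinuous (f \o g).
Proof.
move=> gc lf x a /lf[V gxV Va]; exists (g @^-1` V); first exact: gc.
by move=> y /Va.
Qed.

Lemma lsc_continuous {R : realType} {X : topologicalType} (g : X -> R) :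
  continuous g -> lower_semicontinuous (fun x => (g x)%:E).
Proof.
move=> gc x a; rewrite lte_fin => ag; exists [set y | a < g y].
  by have := gc x => /(cvgr_gt (g x)); apply.
by move=> y /=; rewrite lte_fin.
Qed.

Lemma lsc_add {R : realType} {X : topologicalType} (f g : X -> \bar R) :
  (forall x, f x != -oo%E) -> (forall x, g x != -oo%E) ->
  lower_semicontinuous f -> lower_semicontinuous g ->
  lower_semicontinuous (fun x => f x + g x)%E.
Proof.
move=> fNy gNy lf lg x a afg.
have [b [c [bf cg abc]]] :
    exists b c, [/\ (b%:E < f x)%E, (c%:E < g x)%E & a <= b + c].
  move: afg (fNy x) (gNy x).
  case: (f x) => [u||] //; case: (g x) => [v||] //=.
  - rewrite -EFinD lte_fin => auv _ _.
    exists (u - (u + v - a) / 2), (v - (u + v - a) / 2).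
    by split; rewrite ?lte_fin; lra.
  - by move=> _ _ _; exists (u - 1), (a - u + 1); rewrite ltry lte_fin; split=> //; lra.
  - by move=> _ _ _; exists (a - v + 1), (v - 1); rewrite ltry lte_fin; split=> //; lra.
  - by move=> _ _ _; exists a, 0; rewrite !ltry; split=> //; lra.
have [U xU Ub] := lf _ _ bf; have [V xV Vc] := lg _ _ cg.
exists (U `&` V); first exact: filterI.
move=> y [/Ub fy /Vc gy]; apply: (@le_lt_trans _ _ (b + c)%:E); first by rewrite lee_fin.
by rewrite EFinD; exact: lteD.
Qed.

Lemma lsc_sum {R : realType} {X : topologicalType} (I : eqType) (r : seq I)
    (f : I -> X -> \bar R) :
  (forall i x, f i x != -oo%E) -> (forall i, lower_semicontinuous (f i)) ->
  lower_semicontinuous (fun x => \sum_(i <- r) f i x)%E.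
Proof.
move=> fNy lf; elim: r => [|i r IH].
  move=> x a; rewrite big_nil => a0; exists setT; first exact: filterT.
  by move=> y _; rewrite big_nil.
have sNy x : (\sum_(j <- r) f j x)%E != -oo%E.
  by apply/eqP => /esum_eqNyP[j [_ _ /eqP]]; exact/negP.
move=> x a; rewrite big_cons => /(lsc_add (fNy i) sNy (lf i) IH)[V xV Va].
by exists V => // y /Va; rewrite big_cons.
Qed.

(** Thanks to 0 * +oo = 0, lower semicontinuity survives at a point where the
    weight vanishes and [h] is infinite: there the product is 0, and nearby it is at least
    [g y * C], which tends to 0. *)
Lemma lsc_weighted {R : realType} {X : topologicalType} (g : X -> R)
    (h : X -> \bar R) (C : R) :
  continuous g -> (forall x, 0 <= g x) ->
  lower_semicontinuous h -> (forall x, (C%:E <= h x)%E) ->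
  lower_semicontinuous (fun x => (g x)%:E * h x)%E.
Proof.
move=> gc g0 lh hC x a.
move=> afg; have [gx0|gx0] := eqVneq (g x) 0.
  move: afg; rewrite gx0 mul0e lte_fin => a0.
  have ball_x : nbhs x [set y | g y * `|C| < - a].
    have : g y * `|C| @[y --> x] --> g x * `|C| by apply: cvgMl; exact: gc.
    rewrite gx0 mul0r => /(cvgr_lt 0); apply; lra.
  exists [set y | g y * `|C| < - a] => //.
  move=> y /= hy; apply: (@lt_le_trans _ _ (g y * C)%:E).
    rewrite lte_fin; have := g0 y; have := ler_norm (- C); rewrite normrN; nra.
  by rewrite EFinM; apply: lee_wpmul2l; rewrite ?lee_fin.
have {gx0}gx0 : 0 < g x by rewrite lt_neqAle eq_sym gx0 g0.
(* It is enough to bound [h] below by a real [b] slightly under [h x]. *)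
have [b bh abg] : exists2 b, (b%:E < h x)%E & a < g x * b.
  move: afg (hC x); case: (h x) => [v||] //=.
  - rewrite -EFinM lte_fin => agv _; exists (v - (g x * v - a) / (2 * g x)).
      by rewrite lte_fin ltrBlDr ltrDl divr_gt0; lra.
    rewrite mulrBr (_ : g x * ((g x * v - a) / _) = (g x * v - a) / 2); first by lra.
    by field; lra.
  - move=> _ _; exists ((a + 1) / g x); first exact: ltry.
    by rewrite mulrCA divff ?mulr1; lra.
have [W xW Wb] := lh _ _ bh.
have near_pos : nbhs x [set y | 0 < g y].
  by have := gc x => /(cvgr_gt (g x)); apply.
have near_val : nbhs x [set y | a < g y * b].
  have : g y * b @[y --> x] --> g x * b by apply: cvgMl; exact: gc.
  by move=> /(cvgr_gt (g x * b)); apply.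
exists (W `&` [set y | 0 < g y] `&` [set y | a < g y * b]).
  by apply: filterI => //; exact: filterI.
move=> y /= [[Wy gy0] agy]; apply: (@lt_trans _ _ (g y * b)%:E).
  by rewrite lte_fin.
by rewrite EFinM lte_pmul2l ?lte_fin //; exact: Wb.
Qed.

(** * Distributions over the states *)

Lemma simplexP {R : realType} {n : nat} (rho : 'rV[R]_n) :
  (forall x, 0 <= rho 0 x) -> \sum_x rho 0 x = 1 -> simplex rho.
Proof.
move=> rho0 rho1; split=> // x; rewrite rho0 /= -rho1 (bigD1 x) //= lerDl.
exact: sumr_ge0.
Qed.

Lemma simplex_conv {R : realType} {n : nat} (v w : 'rV[R]_n) (a : R) :
  0 <= a <= 1 -> simplex v -> simplex w -> simplex (a *: v + (1 - a) *: w).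
Proof.
move=> /andP[a0 a1] [v0 v1] [w0 w1]; apply: simplexP => [x|].
  by rewrite !mxE addr_ge0 // mulr_ge0 ?subr_ge0 //;
    [case/andP: (v0 x)|case/andP: (w0 x)].
under eq_bigr do rewrite !mxE.
by rewrite big_split /= -!mulr_sumr v1 w1; ring.
Qed.

Lemma simplex_compact {R : realType} (n : nat) : compact (@simplex R n).
Proof.
apply: (@subclosed_compact _ _ [set v : 'rV[R]_n | forall i, `[0, 1]%classic (v ord0 i)]).
- rewrite (_ : simplex = [set v | forall i, `[0, 1]%classic (v ord0 i)] `&`
      [set v | forall _ : unit, \sum_x v 0 x = 1]); last first.
    apply/seteqP; split=> v [].
      by move=> v0 v1; split=> // i; rewrite /= in_itv /=; exact: v0.
    by move=> v0 /(_ tt) v1; split=> // i; have := v0 i; rewrite /= in_itv.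
  apply: closedI.
    rewrite (_ : (fun v => _) =
        \bigcap_(i in [set: 'I_n]) ((fun v : 'rV[R]_n => v 0 i) @^-1` `[0, 1])).
      apply: closed_bigI => i _; apply: preimage_closed; last exact: itv_closed.
      by move=> v _; exact: coord_continuous.
    by apply/seteqP; split=> v /= v0 i; [move=> _|]; exact: v0.
  apply: (@closed_equations R 'rV[R]_n unit
    (fun _ v => \sum_x v 0 x) (fun _ _ => 1)) => _.
    by apply: continuous_sum => i; exact: coord_continuous.
  exact: cst_continuous.
- by apply: (@rV_compact R n (fun=> `[0, 1]%classic)) => i; exact: segment_compact.
- by move=> v [v0 _] i; rewrite /= in_itv /=; exact: v0.
Qed.

Lemma simplex_nonempty {R : realType} (n : nat) : (0 < n)%N -> @simplex R n !=set0.
Proof.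
case: n => // n _; exists (delta_mx 0 ord0); apply: simplexP => [x|].
  by rewrite mxE; case: eqP.
rewrite (bigD1 ord0) //= mxE !eqxx big1 ?addr0 // => x xN0.
by rewrite mxE (negbTE xN0) andbF.
Qed.

(** The minimum over the simplex is a global lower bound, because [h] is infinite
    elsewhere. *)
Lemma proper_lsc_lbound {R : realType} (n : nat) (h : 'rV[R]_n -> \bar R) :
  (0 < n)%N -> proper h -> lower_semicontinuous h ->
  effective_domain h `<=` simplex -> exists C : R, forall v, (C%:E <= h v)%E.
Proof.
move=> n0 [hNy _] hlsc hdom.
have [v0 _ v0min] := lsc_compact_min (@simplex_compact R n) (simplex_nonempty n0) hlsc.
have vmin v : (h v0 <= h v)%E.
  have [hv|] := ltP (h v) +oo%E; first exact/v0min/hdom.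
  by rewrite leye_eq => /eqP ->; exact: leey.
move: (hNy v0) vmin; case: (h v0) => [C||] // _ vmin; first by exists C.
by exists 0 => v; apply: le_trans (vmin v); exact: leey.
Qed.

(** * Admissible pairs and their mixtures *)

Lemma time_ind (T : nat) (P : 'I_T.+1 -> Prop) :
  P ord0 -> (forall t : 'I_T, P (now t) -> P (next t)) -> forall s, P s.
Proof.
move=> P0 PS [k]; elim: k => [|k IH] hk.
  by rewrite (_ : Ordinal hk = ord0) //; exact: val_inj.
have kT : (k < T)%N by [].
rewrite (_ : Ordinal hk = next (Ordinal kT)); last exact: val_inj.
apply: PS; rewrite (_ : now _ = Ordinal (ltnW hk)); first exact: IH.
exact: val_inj.
Qed.

(** Asking that [m] stays in the simplex makes the set of admissible pairs visibly
    bounded; the flow of a policy has this property by [unperturbed_admissible]. *)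
Definition admissible {R : realType} {T n : nat} (m0 : 'rV[R]_n)
    (m : 'M[R]_(T.+1, n)) (pi : 'I_T -> 'M[R]_n) : Prop :=
  [/\ forall t x, simplex (row x (pi t)), forall s, simplex (row s m),
      forall t x, m (next t) x = \sum_(y < n) m (now t) y * pi t y x &
      forall x, m ord0 x = m0 0 x].

Lemma admissible_ge0 {R : realType} {T n : nat} (m0 : 'rV[R]_n)
    (m : 'M[R]_(T.+1, n)) (pi : 'I_T -> 'M[R]_n) s x :
  admissible m0 m pi -> 0 <= m s x.
Proof. by move=> [_ hm _ _]; have [/(_ x)/andP[+ _] _] := hm s; rewrite mxE. Qed.

Lemma unperturbed_admissible {R : realType} {T n : nat} (m0 : 'rV[R]_n)
    (m : 'M[R]_(T.+1, n)) (pi : 'I_T -> 'M[R]_n) :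
  simplex m0 -> (forall t x, simplex (row x (pi t))) ->
  perturbed_flow m0 0 pi m -> admissible m0 m pi.
Proof.
move=> sm0 spi [h0 hS].
have {}h0 x : m ord0 x = m0 0 x by rewrite -h0 mxE subr0.
have {}hS t x : m (next t) x = \sum_(y < n) m (now t) y * pi t y x.
  by rewrite hS mxE subr0.
split=> //; apply: time_ind.
  by rewrite (_ : row _ _ = m0) //; apply/rowP => x; rewrite mxE h0.
move=> t [mt0 mt1]; apply: simplexP => [x|].
  rewrite mxE hS; apply: sumr_ge0 => y _; apply: mulr_ge0.
    by have := mt0 y; rewrite mxE => /andP[].
  by have [/(_ x) + _] := spi t y; rewrite mxE => /andP[].
under eq_bigr do rewrite mxE hS.
rewrite exchange_big -mt1; apply: eq_bigr => y _ /=.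
have [_ piy1] := spi t y; rewrite -mulr_sumr -[LHS]/(m (now t) y * _).
by rewrite (eq_bigr (fun x => row y (pi t) 0 x)) ?piy1 ?mulr1 ?mxE // => x _; rewrite mxE.
Qed.

(** The quotient by 0 is 0, so that the second identity also holds when
    both masses vanish. *)
Lemma mixing_weight {R : realFieldType} (p q : R) : 0 <= p -> 0 <= q ->
  0 <= p / (p + q) <= 1 /\ (p + q) * (p / (p + q)) = p.
Proof.
move=> p0 q0; have [pq0|pq0] := eqVneq (p + q) 0.
  by rewrite pq0 invr0 mulr0 mul0r lexx ler01; split=> //; lra.
have {pq0}pq : 0 < p + q by rewrite lt_neqAle eq_sym pq0 addr_ge0.
split; last by field; lra.
by rewrite divr_ge0 ?addr_ge0 //= ler_pdivrMr ?mul1r ?lerDl.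
Qed.

(** Convexity of the perspective function (p, p v) |-> p h(v): the two masses are
    pooled and the arguments are averaged in proportion to them. *)
Lemma perspective_convex {R : realType} {V : lmodType R} (h : V -> \bar R)
    (p q : R) (v w : V) :
  convex_ereal h -> (forall u, h u != -oo%E) -> 0 <= p -> 0 <= q ->
  ((p + q)%:E * h ((p / (p + q)) *: v + (1 - p / (p + q)) *: w)%R <=
     p%:E * h v + q%:E * h w)%E.
Proof.
move=> hconv hNy p0 q0; have [] := mixing_weight p0 q0.
set c := p / (p + q) => c01 cE.
have dE : (p + q) * (1 - c) = q by rewrite mulrBr cE; ring.
apply: (@le_trans _ _ ((p + q)%:E * (c%:E * h v + (1 - c)%:E * h w))%E).
  by apply: lee_wpmul2l; [rewrite lee_fin addr_ge0|exact: hconv].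
case/andP: c01 => c0 c1; rewrite muleDr //; first by rewrite !muleA -!EFinM cE dE.
by apply: ltninfty_adde_def; rewrite inE ltNye mule_neqNy ?subr_ge0.
Qed.

(** Admissible pairs are convex in the variables (m, m pi) though not in (m, pi): the
    mixed policy at (t, x) weights [pi1] and [pi2] by the masses that the two flows have
    there. The flow equation and the aggregate depend on m pi only. *)
Lemma mix_admissible {R : realType} {T n : nat} (m0 : 'rV[R]_n)
    (ell : 'I_T -> 'I_n -> 'rV[R]_n -> \bar R)
    (m1 m2 : 'M[R]_(T.+1, n)) (pi1 pi2 : 'I_T -> 'M[R]_n) (a : R) :
  (forall t x, convex_ereal (ell t x)) ->
  (forall t x rho, ell t x rho != -oo%E) ->
  0 <= a <= 1 -> admissible m0 m1 pi1 -> admissible m0 m2 pi2 ->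
  let m := a *: m1 + (1 - a) *: m2 in
  exists pi, [/\ admissible m0 m pi,
    forall t x y, m (now t) x * pi t x y =
      a * (m1 (now t) x * pi1 t x y) + (1 - a) * (m2 (now t) x * pi2 t x y) &
    forall t x, ((m (now t) x)%:E * ell t x (row x (pi t)) <=
      a%:E * ((m1 (now t) x)%:E * ell t x (row x (pi1 t))) +
      (1 - a)%:E * ((m2 (now t) x)%:E * ell t x (row x (pi2 t))))%E].
Proof.
move=> ellconv ellNy /[dup] a01 /andP[a0 a1] adm1 adm2 m.
have p0 s x : 0 <= a * m1 s x by rewrite mulr_ge0 ?(admissible_ge0 _ _ adm1).
have q0 s x : 0 <= (1 - a) * m2 s x.
  by rewrite mulr_ge0 ?subr_ge0 ?(admissible_ge0 _ _ adm2).
have mE s x : m s x = a * m1 s x + (1 - a) * m2 s x by rewrite !mxE.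
pose c t x := a * m1 (now t) x / (a * m1 (now t) x + (1 - a) * m2 (now t) x).
pose pi t : 'M[R]_n := \matrix_(x, y) (c t x * pi1 t x y + (1 - c t x) * pi2 t x y).
have c01 t x : 0 <= c t x <= 1 by have [] := mixing_weight (p0 (now t) x) (q0 (now t) x).
have cE t x : m (now t) x * c t x = a * m1 (now t) x.
  by rewrite mE; have [] := mixing_weight (p0 (now t) x) (q0 (now t) x).
have rowE t x : row x (pi t) = c t x *: row x (pi1 t) + (1 - c t x) *: row x (pi2 t).
  by apply/rowP => y; rewrite !mxE.
have wE t x y : m (now t) x * pi t x y =
    a * (m1 (now t) x * pi1 t x y) + (1 - a) * (m2 (now t) x * pi2 t x y).
  rewrite [pi t x y]mxE mulrDr [m _ _ * (_ * _)]mulrA [m _ _ * ((1 - _) * _)]mulrA.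
  by rewrite mulrBr mulr1 cE mE; ring.
have [spi1 sm1 flow1 init1] := adm1; have [spi2 sm2 flow2 init2] := adm2.
exists pi; split=> // [|t x].
  split=> [t x|s|t x|x].
  - by rewrite rowE; exact: simplex_conv.
  - rewrite (_ : row s m = a *: row s m1 + (1 - a) *: row s m2).
      exact: simplex_conv.
    by apply/rowP => y; rewrite !mxE.
  - rewrite mE flow1 flow2 !mulr_sumr -big_split.
    by apply: eq_bigr => y _; rewrite wE.
  - by rewrite mE init1 init2; ring.
rewrite !muleA -!EFinM mE rowE; exact: perspective_convex.
Qed.

Lemma aggregate_conv {R : realType} {T n : nat} (alpha : 'I_T -> 'M[R]_n)
    (m m1 m2 : 'M[R]_(T.+1, n)) (pi pi1 pi2 : 'I_T -> 'M[R]_n) (a : R) t :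
  (forall t x y, m (now t) x * pi t x y =
      a * (m1 (now t) x * pi1 t x y) + (1 - a) * (m2 (now t) x * pi2 t x y)) ->
  aggregate alpha m pi t =
    a * aggregate alpha m1 pi1 t + (1 - a) * aggregate alpha m2 pi2 t.
Proof.
move=> wE; rewrite !mulr_sumr -big_split; apply: eq_bigr => x _ /=.
rewrite !mulr_sumr -big_split; apply: eq_bigr => y _ /=.
by rewrite wE; ring.
Qed.

(** * Costs attainable under perturbation *)

(** The epigraph of the value function of the perturbed problem, with
    a separate real bound for every term so that convexity reduces to real
    arithmetic. The perturbation [eps] has one component for the argument of [F] and
    one for the argument of [phi]. The flow is left unperturbed: the multiplier of the
    flow equation is the solution of the Bellman equation, which dynamic programming
    provides. *)
Definition attainable {R : realType} {T n : nat} (m0 : 'rV[R]_n)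
    (alpha : 'I_T -> 'M[R]_n) (ell : 'I_T -> 'I_n -> 'rV[R]_n -> \bar R)
    (phi : 'I_T -> R^o -> \bar R) (F : 'I_T.+1 -> 'rV[R]_n -> \bar R)
    (eps : 'M[R]_(T.+1, n) * 'rV[R]_T) (r : R) : Prop :=
  exists m pi (l : 'I_T -> 'I_n -> R) (f : 'I_T.+1 -> R) (p : 'I_T -> R),
  [/\ admissible m0 m pi,
      forall t x, ((m (now t) x)%:E * ell t x (row x (pi t)) <= (l t x)%:E)%E,
      forall s, (F s (row s (m + eps.1)%R) <= (f s)%:E)%E,
      forall t, (phi t (aggregate alpha m pi t + eps.2 0 t)%R <= (p t)%:E)%E &
      r = \sum_t \sum_x l t x + \sum_s f s + \sum_t p t].

Lemma attainable_convex {R : realType} {T n : nat} (m0 : 'rV[R]_n)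
    (alpha : 'I_T -> 'M[R]_n) (ell : 'I_T -> 'I_n -> 'rV[R]_n -> \bar R)
    (phi : 'I_T -> R^o -> \bar R) (F : 'I_T.+1 -> 'rV[R]_n -> \bar R) :
  standing_assumption ell phi F -> convex_rel (attainable m0 alpha ell phi F).
Proof.
move=> [ell_std F_std phi_std] e1 e2 r1 r2 a a01.
move=> [m1 [pi1 [l1 [f1 [p1 [adm1 lB1 fB1 pB1 ->]]]]]].
move=> [m2 [pi2 [l2 [f2 [p2 [adm2 lB2 fB2 pB2 ->]]]]]].
have [||pi [adm wE costE]] :=
  @mix_admissible _ _ _ m0 ell m1 m2 pi1 pi2 a _ _ a01 adm1 adm2.
- by move=> t x; have [] := ell_std t x.
- by move=> t x rho; have [[]] := ell_std t x.
exists (a *: m1 + (1 - a) *: m2), pi.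
exists (fun t x => a * l1 t x + (1 - a) * l2 t x).
exists (fun s => a * f1 s + (1 - a) * f2 s).
exists (fun t => a * p1 t + (1 - a) * p2 t).
split=> //.
- by move=> t x; apply: le_trans (costE t x) _; exact: lee_conv.
- move=> s; have [_ Fconv _] := F_std s.
  rewrite (_ : row s _ = a *: row s (m1 + e1.1) + (1 - a) *: row s (m2 + e2.1)).
    by apply: le_trans (Fconv _ _ _ a01) _; exact: lee_conv.
  by apply/rowP => x; rewrite !mxE; ring.
- move=> t; have [_ phiconv _] := phi_std t.
  rewrite (aggregate_conv _ _ wE).
  rewrite (_ : _ + _ = a *: (aggregate alpha m1 pi1 t + e1.2 0 t : R^o) +
                       (1 - a) *: (aggregate alpha m2 pi2 t + e2.2 0 t : R^o)).
    by apply: le_trans (phiconv _ _ _ a01) _; exact: lee_conv.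
  by rewrite !mxE /GRing.scale /=; ring.
- rewrite !big_split /= -!mulr_sumr.
  under [X in _ = X + _ + _]eq_bigr do rewrite big_split /= -!mulr_sumr.
  by rewrite big_split /= -!mulr_sumr; ring.
Qed.

Lemma enormK_scale {R : realType} {T n : nat} (a : R)
    (e1 e2 : 'M[R]_(T.+1, n)) (e3 : 'rV[R]_T) : 0 <= a ->
  enormK (a *: e1) (a *: e2) (a *: e3) = a * enormK e1 e2 e3.
Proof.
move=> a0; have scale2 k (e : 'M[R]_(k, n)) :
    \sum_s \sum_x (a *: e) s x ^+ 2 = a ^+ 2 * \sum_s \sum_x e s x ^+ 2.
  rewrite mulr_sumr; apply: eq_bigr => s _.
  by rewrite mulr_sumr; apply: eq_bigr => x _; rewrite mxE exprMn.
have -> : a * enormK e1 e2 e3 = Num.sqrt (a ^+ 2) * enormK e1 e2 e3.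
  by rewrite sqrtr_sqr ger0_norm.
rewrite /enormK -sqrtrM ?sqr_ge0 // !mulrDr -!scale2; congr (Num.sqrt (_ + _)).
by rewrite mulr_sumr; apply: eq_bigr => t _; rewrite mxE exprMn.
Qed.

(** The qualification on a small multiple of the perturbation, with unperturbed flow:
    the policy it provides has all its costs finite. *)
Lemma attainable_absorbing {R : realType} {T n : nat} (m0 : 'rV[R]_n)
    (alpha : 'I_T -> 'M[R]_n) (ell : 'I_T -> 'I_n -> 'rV[R]_n -> \bar R)
    (phi : 'I_T -> R^o -> \bar R) (F : 'I_T.+1 -> 'rV[R]_n -> \bar R) :
  simplex m0 -> standing_assumption ell phi F -> qualification m0 alpha ell phi F ->
  absorbing_rel (attainable m0 alpha ell phi F).
Proof.
move=> sm0 [ell_std F_std phi_std] [alpha0 alpha0_gt0 qual] [d2 d3].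
(* Adding 1 avoids a division by 0 in the direction 0. *)
have dn0 : 0 < enormK 0 d2 d3 + 1 by rewrite ltr_wpDl // sqrtr_ge0.
pose a := alpha0 / (enormK 0 d2 d3 + 1).
have a_gt0 : 0 < a by rewrite divr_gt0.
exists a => //.
have [|pi [m [ell_fin [flow m_ge0 F_fin phi_fin]]]] := qual 0 (a *: d2) (a *: d3).
  have -> : enormK 0 (a *: d2) (a *: d3) = a * enormK 0 d2 d3.
    by rewrite -enormK_scale ?ltW // scaler0.
  by rewrite /a mulrAC ler_pdivrMr // ler_pM2l // lerDl.
have fin (V : Type) (h : V -> \bar R) v : proper h -> effective_domain h v ->
    h v = (fine (h v))%:E.
  by move=> [hNy _] hv; rewrite fineK // fin_numE hNy /= -ltey.
pose l t x := m (now t) x * fine (ell t x (row x (pi t))).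
pose f s := fine (F s (row s (m + a *: d2))).
pose p t := fine (phi t (aggregate alpha m pi t + (a *: d3) 0 t)).
exists (\sum_t \sum_x l t x + \sum_s f s + \sum_t p t), m, pi, l, f, p; split=> //.
- apply: unperturbed_admissible => // t x.
  by have [_ _ _ sub] := ell_std t x; apply: sub.
- move=> t x; have [ell_proper _ _ _] := ell_std t x.
  by rewrite [ell _ _ _]fin // EFinM.
- by move=> s; have [F_proper _ _] := F_std s; rewrite [F _ _]fin.
- by move=> t; have [phi_proper _ _] := phi_std t; rewrite [phi _ _]fin.
Qed.

(** * Existence of a minimiser *)

(** The absolute value is harmless on admissible pairs, and makes the weight
    nonnegative, hence the cost lower semicontinuous, on the whole product space. *)
Definition total_cost {R : realType} {T n : nat}
    (alpha : 'I_T -> 'M[R]_n) (ell : 'I_T -> 'I_n -> 'rV[R]_n -> \bar R)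
    (phi : 'I_T -> R^o -> \bar R) (F : 'I_T.+1 -> 'rV[R]_n -> \bar R)
    (m : 'M[R]_(T.+1, n)) (pi : 'I_T -> 'M[R]_n) : \bar R :=
  (\sum_t \sum_x (`|m (now t) x|)%:E * ell t x (row x (pi t)) +
   \sum_s F s (row s m) + \sum_t phi t (aggregate alpha m pi t))%E.

Section Configurations.

Context {R : realType} {T n : nat}.

(** A pair (m, pi) as a single point of a product of lines, so that compactness is
    Tychonoff's theorem and continuity can be checked coordinatewise. *)
Definition configuration : topologicalType :=
  prod_topology (fun _ : ('I_T.+1 * 'I_n) + ('I_T * 'I_n * 'I_n) => R).

Definition state_of (z : configuration) : 'M[R]_(T.+1, n) :=
  \matrix_(s, x) z (inl (s, x)).

Definition policy_of (z : configuration) (t : 'I_T) : 'M[R]_n :=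
  \matrix_(x, y) z (inr (t, x, y)).

Lemma coordinate_continuous i : continuous (fun z : configuration => z i : R).
Proof. exact: (@proj_continuous _ (fun=> R) i). Qed.

Lemma state_continuous s x : continuous (fun z => state_of z s x).
Proof.
rewrite (_ : (fun z => _) = fun z : configuration => z (inl (s, x)) : R).
  exact: coordinate_continuous.
by apply/funext => z; rewrite mxE.
Qed.

Lemma policy_continuous t x y : continuous (fun z => policy_of z t x y).
Proof.
rewrite (_ : (fun z => _) = fun z : configuration => z (inr (t, x, y)) : R).
  exact: coordinate_continuous.
by apply/funext => z; rewrite mxE.
Qed.

Lemma row_state_continuous s : continuous (fun z => row s (state_of z)).
Proof.
apply: continuous_rV => x.
under eq_fun do rewrite mxE.
exact: state_continuous.
Qed.

Lemma row_policy_continuous t x : continuous (fun z => row x (policy_of z t)).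
Proof.
apply: continuous_rV => y.
under eq_fun do rewrite mxE.
exact: policy_continuous.
Qed.

Lemma aggregate_continuous alpha t :
  continuous (fun z => aggregate alpha (state_of z) (policy_of z) t).
Proof.
apply: continuous_sum => x; apply: continuous_sum => y.
apply: continuous_mul; last exact: cst_continuous.
by apply: continuous_mul; [exact: state_continuous|exact: policy_continuous].
Qed.

(** All coordinates are probabilities, so they lie in a cube; what
    remains is a family of polynomial equations. *)
Lemma admissible_compact (m0 : 'rV[R]_n) :
  compact [set z | admissible m0 (state_of z) (policy_of z)].
Proof.
pose box := [set z : configuration | forall i, `[0, 1]%classic (z i : R)].
pose policy_mass := [set z | forall i : 'I_T * 'I_n, \sum_y policy_of z i.1 i.2 y = 1].
pose state_mass := [set z | forall s, \sum_x state_of z s x = 1].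
pose flow := [set z | forall i : 'I_T * 'I_n, state_of z (next i.1) i.2 =
   \sum_y state_of z (now i.1) y * policy_of z i.1 y i.2].
pose init := [set z | forall x, state_of z ord0 x = m0 0 x].
have boxc : compact box.
  by apply: (@tychonoff _ (fun=> R) (fun=> `[0, 1]%classic)) => i; exact: segment_compact.
have -> : [set z | admissible m0 (state_of z) (policy_of z)] =
    box `&` (policy_mass `&` (state_mass `&` (flow `&` init))).
  apply/seteqP; split=> z /=.
    move=> [spi sm flowz initz]; split; last split; last split; last split => //.
    - case=> [[s x]|[[t x] y]]; rewrite /= in_itv /=.
        by have [/(_ x)] := sm s; rewrite !mxE.
      by have [/(_ y)] := spi t x; rewrite !mxE.
    - case=> t x /=; have [_ <-] := spi t x; apply: eq_bigr => y _; by rewrite !mxE.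
    - move=> s /=; have [_ <-] := sm s; apply: eq_bigr => y _; by rewrite !mxE.
  move=> [bz [pmz [smz [fz iz]]]]; split=> //.
  - move=> t x; split.
      by move=> y; have := bz (inr (t, x, y)); rewrite /= in_itv /= !mxE.
    by rewrite -(pmz (t, x)); apply: eq_bigr => y _; rewrite !mxE.
  - move=> s; split.
      by move=> x; have := bz (inl (s, x)); rewrite /= in_itv /= !mxE.
    by rewrite -(smz s); apply: eq_bigr => y _; rewrite !mxE.
  - by move=> t x; exact: (fz (t, x)).
apply: compact_closedI => //.
apply: closedI; last apply: closedI; last apply: closedI.
- apply: closed_equations => i; last exact: cst_continuous.
  by apply: continuous_sum => y; exact: policy_continuous.
- apply: closed_equations => i; last exact: cst_continuous.
  by apply: continuous_sum => y; exact: state_continuous.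
- apply: closed_equations => i; first exact: state_continuous.
  apply: continuous_sum => y; apply: continuous_mul.
    exact: state_continuous.
  exact: policy_continuous.
- apply: closed_equations => i; last exact: cst_continuous.
  exact: state_continuous.
Qed.

End Configurations.

Lemma total_cost_lsc {R : realType} {T n : nat} (alpha : 'I_T -> 'M[R]_n)
    (ell : 'I_T -> 'I_n -> 'rV[R]_n -> \bar R)
    (phi : 'I_T -> R^o -> \bar R) (F : 'I_T.+1 -> 'rV[R]_n -> \bar R) :
  (0 < n)%N -> standing_assumption ell phi F ->
  lower_semicontinuous
    (fun z => total_cost alpha ell phi F (state_of z) (policy_of z)).
Proof.
move=> n0 [ell_std F_std phi_std].
have ellNy t x v : ell t x v != -oo%E by have [[]] := ell_std t x.
have FNy s v : F s v != -oo%E by have [[]] := F_std s.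
have phiNy t v : phi t v != -oo%E by have [[]] := phi_std t.
apply: lsc_add.
- move=> z; rewrite /= adde_eq_ninfty negb_or !sume_neqNy // => t.
  by apply: sume_neqNy => x; rewrite mule_neqNy.
- by move=> z; exact: sume_neqNy.
- apply: lsc_add.
  + by move=> z; do 2!apply: sume_neqNy => ?; rewrite mule_neqNy.
  + by move=> z; exact: sume_neqNy.
  + apply: lsc_sum => [t z|t]; first by apply: sume_neqNy => x; rewrite mule_neqNy.
    apply: lsc_sum => [x z|x]; first by rewrite mule_neqNy.
    have [ell_proper _ ell_lsc ell_dom] := ell_std t x.
    have [C CP] := proper_lsc_lbound n0 ell_proper ell_lsc ell_dom.
    apply: (@lsc_weighted _ _ _ _ C) => //.
      move=> z; apply: (@continuous_comp _ _ _ (fun z => state_of z (now t) x) Num.norm).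
        exact: state_continuous.
      exact: norm_continuous.
    exact: (lsc_comp (@row_policy_continuous _ _ _ t x) ell_lsc).
  + apply: lsc_sum => // s; have [_ _ F_lsc] := F_std s.
    exact: (lsc_comp (@row_state_continuous _ _ _ s) F_lsc).
- apply: lsc_sum => // t; have [_ _ phi_lsc] := phi_std t.
  exact: (lsc_comp (@aggregate_continuous _ _ _ alpha t) phi_lsc).
Qed.

(** Lower semicontinuity gives a minimiser of the extended-real cost. The minimum is
    finite and no term is -oo, so each term is finite, and the minimiser has real
    bounds term by term. *)
Lemma attainable_minimum {R : realType} {T n : nat} (m0 : 'rV[R]_n)
    (alpha : 'I_T -> 'M[R]_n) (ell : 'I_T -> 'I_n -> 'rV[R]_n -> \bar R)
    (phi : 'I_T -> R^o -> \bar R) (F : 'I_T.+1 -> 'rV[R]_n -> \bar R) :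
  (0 < n)%N -> standing_assumption ell phi F ->
  (exists r, attainable m0 alpha ell phi F 0 r) ->
  exists2 r0, attainable m0 alpha ell phi F 0 r0 &
    forall r, attainable m0 alpha ell phi F 0 r -> r0 <= r.
Proof.
move=> n0 std [r1 att1].
pose J z := total_cost alpha ell phi F (state_of z) (policy_of z).
pose A := [set z : @configuration R T n | admissible m0 (state_of z) (policy_of z)].
have below r : attainable m0 alpha ell phi F 0 r -> exists2 z, A z & (J z <= r%:E)%E.
  move=> [m [pi [l [f [p [adm lB fB pB ->]]]]]].
  pose z : configuration := fun i => match i with
    | inl (s, x) => m s x | inr (t, x, y) => pi t x y end.
  have zm : state_of z = m by apply/matrixP => s x; rewrite mxE.
  have zpi : policy_of z = pi.
    by apply/funext => t; apply/matrixP => x y; rewrite mxE.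
  exists z; rewrite /A /J /= zm zpi // !EFinD -!sumEFin.
  apply: leeD; first apply: leeD; apply: lee_sum => t _.
  - rewrite -sumEFin; apply: lee_sum => x _.
    by rewrite ger0_norm ?(admissible_ge0 _ _ adm).
  - by have := fB t; rewrite addr0.
  - by have := pB t; rewrite mxE addr0.
have [z1 Az1 Jz1] := below _ att1.
have [z Az zmin] := lsc_compact_min (@admissible_compact R T n m0)
  (ex_intro _ z1 Az1) (@total_cost_lsc R T n alpha ell phi F n0 std).
have [ell_std F_std phi_std] := std.
have ellNy t x v : ell t x v != -oo%E by have [[]] := ell_std t x.
have FNy s v : F s v != -oo%E by have [[]] := F_std s.
have phiNy t v : phi t v != -oo%E by have [[]] := phi_std t.
have Jz_fin : (J z < +oo)%E.
  by apply: le_lt_trans (zmin _ Az1) (le_lt_trans Jz1 (ltry _)).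
set m := state_of z in Jz_fin Az; set pi := policy_of z in Jz_fin Az.
have m_ge0 t x : 0 <= m t x by exact: admissible_ge0 Az.
have costNy t x : (`|m (now t) x|%:E * ell t x (row x (pi t)))%E != -oo%E.
  by rewrite mule_neqNy.
have row_costNy t : (\sum_x `|m (now t) x|%:E * ell t x (row x (pi t)))%E != -oo%E.
  exact: sume_neqNy.
have [] := adde_lty _ _ Jz_fin; [|exact: sume_neqNy|].
  by rewrite adde_eq_ninfty negb_or !sume_neqNy.
move=> /adde_lty[||/sume_lty lfin /sume_lty Ffin /sume_lty phifin]; try exact: sume_neqNy.
have fin (y : \bar R) : y != -oo%E -> (y < +oo)%E -> y = (fine y)%:E.
  by move=> yNy yy; rewrite fineK // fin_numE yNy -ltey.
pose l t x := fine (`|m (now t) x|%:E * ell t x (row x (pi t))).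
pose f s := fine (F s (row s m)).
pose p t := fine (phi t (aggregate alpha m pi t)).
have lE t x : (`|m (now t) x|%:E * ell t x (row x (pi t)))%E = (l t x)%:E.
  by apply: fin => //; exact: (sume_lty (costNy t) (lfin row_costNy t)).
have fE s : F s (row s m) = (f s)%:E.
  by apply: fin => //; exact: Ffin (fun s' => FNy s' _) s.
have pE t : phi t (aggregate alpha m pi t) = (p t)%:E.
  by apply: fin => //; exact: phifin (fun t' => phiNy t' _) t.
have JE : J z = (\sum_t \sum_x l t x + \sum_s f s + \sum_t p t)%:E.
  rewrite !EFinD -!sumEFin; congr (_ + _ + _)%E; apply: eq_bigr => t _ //.
  by rewrite -sumEFin; apply: eq_bigr => x _.
exists (\sum_t \sum_x l t x + \sum_s f s + \sum_t p t).
  exists m, pi, l, f, p; split=> //.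
  - by move=> t x; rewrite -lE ger0_norm.
  - by move=> s; rewrite addr0 fE.
  - by move=> t; rewrite mxE addr0 pE.
move=> r /below[z' Az' Jz']; rewrite -lee_fin -JE.
exact: le_trans (zmin _ Az') Jz'.
Qed.

(** * Multipliers *)

Lemma sum_replace {R : realType} (I : finType) (f : I -> R) (i : I) (a : R) :
  \sum_j (if j == i then a else f j) = \sum_j f j - f i + a.
Proof.
rewrite (bigD1 i) //= eqxx [in RHS](bigD1 i) //=.
rewrite (eq_bigr f) => [|j /negbTE -> //]; lra.
Qed.

Lemma linear_pairing {R : realType} {T n : nat}
    (h : {linear ('M[R]_(T.+1, n) * 'rV[R]_T)%type -> R^o}) :
  exists (gamma : 'M[R]_(T.+1, n)) (P : 'rV[R]_T), forall e d,
    h (e, d) = \sum_s \sum_x gamma s x * e s x + \sum_t P 0 t * d 0 t.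
Proof.
exists (\matrix_(s, x) h (delta_mx s x, 0)), (\row_t h (0, delta_mx 0 t)) => e d.
have -> : h (e, d) = h (e, 0) + h (0, d).
  by rewrite -linearD; congr (h (_, _)); rewrite ?addr0 ?add0r.
have hl : {morph (fun e => h (e, 0)) : x y / x + y}.
  by move=> x y /=; rewrite -linearD; congr (h (_, _)); rewrite addr0.
have hr : {morph (fun d => h (0, d)) : x y / x + y}.
  by move=> x y /=; rewrite -linearD; congr (h (_, _)); rewrite addr0.
have hlZ a x : h (a *: x, 0) = a * h (x, 0).
  by rewrite -[RHS](linearZ_LR h a (x, 0)); congr (h (_, _)); rewrite scaler0.
have hrZ a x : h (0, a *: x) = a * h (0, x).
  by rewrite -[RHS](linearZ_LR h a (0, x)); congr (h (_, _)); rewrite scaler0.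
congr (_ + _).
  rewrite {1}(matrix_sum_delta e) (big_morph _ hl (linear0 h)).
  apply: eq_bigr => s _; rewrite (big_morph _ hl (linear0 h)).
  by apply: eq_bigr => x _; rewrite hlZ mxE mulrC.
rewrite {1}(row_sum_delta d) (big_morph _ hr (linear0 h)).
by apply: eq_bigr => t _; rewrite hrZ mxE mulrC.
Qed.

(** The multipliers represent a subgradient at 0 of the value function. Each
    conclusion tests the subgradient inequality against a suitable attainable
    point: keeping [m], [pi], one changes [m] into [w] in the single term [F s],
    respectively the aggregate into [w] in the single term [phi t]; or one takes another
    admissible pair [m'], [pi'] and perturbs it back, by [m - m'] and the difference of the
    aggregates, so that the [F] and [phi] terms keep their optimal values. *)
Lemma multipliers_exist {R : realType} {T n : nat} (m0 : 'rV[R]_n)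
    (alpha : 'I_T -> 'M[R]_n) (ell : 'I_T -> 'I_n -> 'rV[R]_n -> \bar R)
    (phi : 'I_T -> R^o -> \bar R) (F : 'I_T.+1 -> 'rV[R]_n -> \bar R) :
  (0 < n)%N -> simplex m0 -> standing_assumption ell phi F ->
  qualification m0 alpha ell phi F ->
  exists m pi (gamma : 'M[R]_(T.+1, n)) (P : 'rV[R]_T) (l : 'I_T -> 'I_n -> R),
  [/\ admissible m0 m pi,
      forall s, subdifferential dot (F s) (row s m) (row s gamma),
      forall t, subdifferential ( *%R : R^o -> R^o -> R) (phi t)
                  (aggregate alpha m pi t) (P 0 t),
      forall t x, ((m (now t) x)%:E * ell t x (row x (pi t)) <= (l t x)%:E)%E &
      forall m' pi' l', admissible m0 m' pi' ->
        (forall t x,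
           ((m' (now t) x)%:E * ell t x (row x (pi' t)) <= (l' t x)%:E)%E) ->
        \sum_t \sum_x l t x + \sum_s \sum_x gamma s x * m s x +
          \sum_t P 0 t * aggregate alpha m pi t <=
        \sum_t \sum_x l' t x + \sum_s \sum_x gamma s x * m' s x +
          \sum_t P 0 t * aggregate alpha m' pi' t].
Proof.
move=> n0 sm0 std qual.
have att_abs := attainable_absorbing sm0 std qual.
have [|r0 att0 r0min] := @attainable_minimum R T n m0 alpha ell phi F n0 std.
  by have [a _ [r]] := att_abs 0; rewrite scaler0; exists r.
have [h hP] := subgradient_exists (attainable_convex std) att_abs r0min.
have [gamma [P hE]] := linear_pairing h.
move: att0 hP => [m [pi [l [f [p [adm lB fB pB r0E]]]]]] hP.
have {}fB s : (F s (row s m) <= (f s)%:E)%E by have := fB s; rewrite addr0.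
have {}pB t : (phi t (aggregate alpha m pi t) <= (p t)%:E)%E.
  by have := pB t; rewrite mxE addr0.
have [ell_std F_std phi_std] := std.
have finle (y : \bar R) c : y != -oo%E -> (y <= c%:E)%E -> y \is a fin_num.
  by move=> yNy yc; rewrite fin_numE yNy -ltey (le_lt_trans yc) ?ltry.
exists m, pi, gamma, P, l; split=> //.
- move=> s; have [[FNy _] _ _] := F_std s; split; first exact: finle (fB s).
  move=> w; have [Fw|] := ltP (F s w) +oo%E; last first.
    by rewrite leye_eq => /eqP ->; exact: leey.
  pose e : 'M[R]_(T.+1, n) := \matrix_(s', x) (if s' == s then w 0 x - m s x else 0).
  pose f' s' := if s' == s then fine (F s w) else f s'.
  have FwE : F s w = (fine (F s w))%:E by rewrite fineK // fin_numE FNy -ltey.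
  have : attainable m0 alpha ell phi F (e, 0)
      (\sum_t \sum_x l t x + \sum_s' f' s' + \sum_t p t).
    exists m, pi, l, f', p; split=> // [s'|t]; last by rewrite mxE addr0.
    rewrite /f'; case: eqP => [->|/eqP/negbTE ss'].
      rewrite (_ : row s _ = w) -?FwE //.
      by apply/rowP => x; rewrite !mxE eqxx addrC subrK.
    by rewrite (_ : row s' _ = row s' m) //; apply/rowP => x; rewrite !mxE ss' addr0.
  move/hP; rewrite r0E hE sum_replace.
  rewrite [X in X + \sum_t P 0 t * _]
    (_ : _ = dot (row s gamma) (w - row s m)); last first.
    rewrite (bigD1 s) //= [X in _ + X]big1 => [|s' /negbTE ss'].
      by rewrite addr0; apply: eq_bigr => x _; rewrite !mxE eqxx.
    by apply: big1 => x _; rewrite mxE ss' mulr0.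
  have -> : \sum_t P 0 t * (0 : 'rV[R]_T) 0 t = 0.
    by apply: big1 => t _; rewrite mxE mulr0.
  move=> hle; rewrite FwE; apply: le_trans (leeD (fB s) (lexx _)) _.
  by rewrite -EFinD lee_fin; lra.
- move=> t; have [[phiNy _] _ _] := phi_std t; split; first exact: finle (pB t).
  move=> w; have [phiw|] := ltP (phi t w) +oo%E; last first.
    by rewrite leye_eq => /eqP ->; exact: leey.
  pose d : 'rV[R]_T := \row_t' (if t' == t then w - aggregate alpha m pi t else 0).
  pose p' t' := if t' == t then fine (phi t w) else p t'.
  have phiwE : phi t w = (fine (phi t w))%:E by rewrite fineK // fin_numE phiNy -ltey.
  have : attainable m0 alpha ell phi F (0, d)
      (\sum_t \sum_x l t x + \sum_s f s + \sum_t' p' t').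
    exists m, pi, l, f, p'; split=> // [s|t']; first by rewrite addr0.
    rewrite /p' mxE /=; case: eqP => [->|_]; last by rewrite addr0.
    by rewrite addrC subrK -phiwE.
  move/hP; rewrite r0E hE sum_replace.
  have -> : \sum_s \sum_x gamma s x * (0 : 'M[R]_(T.+1, n)) s x = 0.
    by apply: big1 => s _; apply: big1 => x _; rewrite mxE mulr0.
  have -> : \sum_t' P 0 t' * d 0 t' = P 0 t * (w - aggregate alpha m pi t).
    rewrite (bigD1 t) //= big1 => [|t' /negbTE tt']; last by rewrite mxE tt' mulr0.
    by rewrite addr0 mxE eqxx.
  move=> hle; rewrite phiwE; apply: le_trans (leeD (pB t) (lexx _)) _.
  by rewrite -EFinD lee_fin; lra.
- move=> m' pi' l' adm' lB'.
  pose d : 'rV[R]_T := \row_t (aggregate alpha m pi t - aggregate alpha m' pi' t).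
  have : attainable m0 alpha ell phi F (m - m', d)
      (\sum_t \sum_x l' t x + \sum_s f s + \sum_t p t).
    exists m', pi', l', f, p; split=> // [s|t]; first by rewrite /= addrC subrK.
    by rewrite mxE /= addrC subrK.
  move/hP; rewrite r0E hE.
  have -> : \sum_s \sum_x gamma s x * (m - m') s x =
      \sum_s \sum_x gamma s x * m s x - \sum_s \sum_x gamma s x * m' s x.
    rewrite -sumrB; apply: eq_bigr => s _; rewrite -sumrB.
    by apply: eq_bigr => x _; rewrite !mxE mulrBr.
  have -> : \sum_t P 0 t * d 0 t = \sum_t P 0 t * aggregate alpha m pi t -
      \sum_t P 0 t * aggregate alpha m' pi' t.
    by rewrite -sumrB; apply: eq_bigr => t _; rewrite mxE mulrBr.
  lra.
Qed.

(** * Dynamic programming *)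

(** One Bellman step: adding a continuous function to [h] keeps it lower semicontinuous,
    and its minimum over the compact simplex is finite because [h] is proper. *)
Lemma optimal_distribution {R : realType} {n : nat} (h : 'rV[R]_n -> \bar R)
    (g : R) (b : 'I_n -> R) :
  proper h -> lower_semicontinuous h -> effective_domain h `<=` simplex ->
  exists rho c, [/\ simplex rho,
    (h rho + g%:E + (\sum_y rho 0 y * b y)%R%:E)%E = c%:E &
    forall rho', (c%:E <= h rho' + g%:E + (\sum_y rho' 0 y * b y)%R%:E)%E].
Proof.
move=> [hNy [v hv]] hlsc hdom.
pose J rho := (h rho + (g + \sum_y rho 0 y * b y)%R%:E)%E.
have JE rho : (h rho + g%:E + (\sum_y rho 0 y * b y)%R%:E)%E = J rho.
  by rewrite -addeA -EFinD.
have Jlsc : lower_semicontinuous J.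
  apply: (@lsc_add _ _ h (fun rho => (g + \sum_y rho 0 y * b y)%R%:E)) => //.
  apply: lsc_continuous; apply: continuous_add; first exact: cst_continuous.
  apply: continuous_sum => y.
  by apply: continuous_mul; [exact: coord_continuous|exact: cst_continuous].
have [rho srho rhomin] :=
  lsc_compact_min (@simplex_compact R n) (ex_intro _ v (hdom v hv)) Jlsc.
have Jrho : J rho \is a fin_num.
  rewrite fin_numE; apply/andP; split; first by rewrite /J; case: (h rho) (hNy rho).
  rewrite -ltey; apply: (le_lt_trans (rhomin v (hdom v hv))).
  by rewrite /J; move: hv (hNy v); case: (h v) => // r _ _; exact: ltry.
exists rho, (fine (J rho)); split=> // [|rho']; first by rewrite JE fineK.
rewrite JE fineK //; have [hr|] := ltP (h rho') +oo%E; first exact/rhomin/hdom.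
by rewrite leye_eq /J => /eqP ->; exact: leey.
Qed.

Lemma backward_recursion {A : Type} {T : nat} (terminal : A) (step : 'I_T -> A -> A) :
  exists u : 'I_T.+1 -> A,
    u ord_max = terminal /\ forall t, u (now t) = step t (u (next t)).
Proof.
elim: T step => [|T IH] step; first by exists (fun=> terminal); split=> // -[].
have [u [uT uS]] := IH (fun t => step (lift ord0 t)).
exists (fun s => if unlift ord0 s is Some s' then u s' else step ord0 (u ord0)).
split=> [|t].
  by rewrite (_ : ord_max = lift ord0 ord_max) ?liftK //; exact: val_inj.
rewrite /next liftK; have [t'|] := unliftP ord0 t; last first.
  by move=> ->; rewrite (_ : now ord0 = ord0) ?unlift_none //; exact: val_inj.
move=> ->; rewrite (_ : now (lift ord0 t') = lift ord0 (now t')); last exact: val_inj.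
by rewrite liftK uS.
Qed.

(** The minimal value and a minimiser are selected as functions of the
    next values [v]; this defines the steps of a backward recursion. *)
Lemma bellman_exists {R : realType} {T n : nat}
    (alpha : 'I_T -> 'M[R]_n) (ell : 'I_T -> 'I_n -> 'rV[R]_n -> \bar R)
    (phi : 'I_T -> R^o -> \bar R) (F : 'I_T.+1 -> 'rV[R]_n -> \bar R)
    (gamma : 'M[R]_(T.+1, n)) (P : 'rV[R]_T) :
  standing_assumption ell phi F ->
  exists (u : 'M[R]_(T.+1, n)) (pi : 'I_T -> 'M[R]_n),
    (forall x, u ord_max x = gamma ord_max x) /\
    forall t x, [/\ simplex (row x (pi t)),
      cost alpha ell u gamma P t x (row x (pi t)) = (u (now t) x)%:E &
      forall rho, ((u (now t) x)%:E <= cost alpha ell u gamma P t x rho)%E].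
Proof.
move=> [ell_std _ _].
have /choice[best bestP] (i : 'I_T * 'I_n * 'rV[R]_n) : exists rc : 'rV[R]_n * R,
  let: (t, x, v) := i in
  let J rho := (ell t x rho + (gamma (now t) x)%:E +
    (\sum_y rho 0 y * (alpha t x y * P 0 t + v 0 y))%R%:E)%E in
  [/\ simplex rc.1, J rc.1 = rc.2%:E & forall rho, (rc.2%:E <= J rho)%E].
  case: i => [[t x] v]; have [ell_proper _ ell_lsc ell_dom] := ell_std t x.
  have [rho [c [srho rhoE cmin]]] := optimal_distribution (gamma (now t) x)
    (fun y => alpha t x y * P 0 t + v 0 y) ell_proper ell_lsc ell_dom.
  by exists (rho, c).
have [w [wT wS]] := backward_recursion (row ord_max gamma)
  (fun t v => \row_x (best (t, x, v)).2 : 'rV[R]_n).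
pose u : 'M[R]_(T.+1, n) := \matrix_(s, x) w s 0 x.
exists u, (fun t => \matrix_(x, y) (best (t, x, w (next t))).1 0 y).
split=> [x|t x]; first by rewrite mxE wT mxE.
have [sb bE bmin] := bestP (t, x, w (next t)).
rewrite (_ : row x _ = (best (t, x, w (next t))).1); last first.
  by apply/rowP => y; rewrite !mxE.
have -> : u (now t) x = (best (t, x, w (next t))).2 by rewrite mxE wS mxE.
have costE rho : cost alpha ell u gamma P t x rho =
    (ell t x rho + (gamma (now t) x)%:E +
     (\sum_y rho 0 y * (alpha t x y * P 0 t + w (next t) 0 y))%R%:E)%E.
  by rewrite /cost; congr (_ + _%:E)%E; apply: eq_bigr => y _; rewrite [u _ _]mxE.
by split=> // [|rho]; rewrite costE.
Qed.

(** The linearised cost of a policy, without its running cost [ell]: by the flow equation,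
    the sum over [x] of m(t,x) times the expectation of u(t+1) is the pairing of
    m(t+1) with u(t+1), and the sum over [t] telescopes. The pairing left at the horizon
    is the terminal price, since [u] and [gamma] agree there. *)
Lemma telescoped_value {R : realType} {T n : nat} (m0 : 'rV[R]_n)
    (alpha : 'I_T -> 'M[R]_n) (m u gamma : 'M[R]_(T.+1, n))
    (pi : 'I_T -> 'M[R]_n) (P : 'rV[R]_T) :
  admissible m0 m pi -> (forall x, u ord_max x = gamma ord_max x) ->
  \sum_s \sum_x gamma s x * m s x + \sum_t P 0 t * aggregate alpha m pi t =
  \sum_x m0 0 x * u ord0 x +
  \sum_t \sum_x m (now t) x * (gamma (now t) x +
     \sum_y pi t x y * (alpha t x y * P 0 t + u (next t) y) - u (now t) x).
Proof.
move=> [_ _ flow init] uT.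
pose W s := \sum_x m s x * u s x; pose G s := \sum_x gamma s x * m s x.
have WT : W ord_max = G ord_max.
  by apply: eq_bigr => x _; rewrite uT mulrC.
have W0 : \sum_x m0 0 x * u ord0 x = W ord0.
  by apply: eq_bigr => x _; rewrite init.
have stage t : \sum_x m (now t) x * (gamma (now t) x +
     \sum_y pi t x y * (alpha t x y * P 0 t + u (next t) y) - u (now t) x) =
   G (now t) + P 0 t * aggregate alpha m pi t + W (next t) - W (now t).
  have -> : W (next t) = \sum_x \sum_y m (now t) x * pi t x y * u (next t) y.
    rewrite exchange_big; apply: eq_bigr => y _ /=.
    by rewrite flow mulr_suml.
  rewrite /G /W /aggregate mulr_sumr -!big_split -sumrB; apply: eq_bigr => x _ /=.
  rewrite mulrBr mulrDr [gamma _ _ * _]mulrC; congr (_ - _).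
  rewrite -addrA; congr (_ + _); rewrite !mulr_sumr -big_split.
  by apply: eq_bigr => y _ /=; ring.
rewrite (eq_bigr _ (fun t _ => stage t)) W0 sumrB !big_split /=.
have sumG : \sum_s G s = \sum_t G (now t) + G ord_max by rewrite big_ord_recr.
have sumW : \sum_t W (now t) + W ord_max = W ord0 + \sum_t W (next t).
  by rewrite -[RHS]big_ord_recl big_ord_recr.
rewrite -/(\sum_s G s) -[\sum_s \sum_x _]/(\sum_s G s) sumG.
lra.
Qed.

Lemma cost_rowE {R : realType} {T n : nat} (alpha : 'I_T -> 'M[R]_n)
    (ell : 'I_T -> 'I_n -> 'rV[R]_n -> \bar R) (u gamma : 'M[R]_(T.+1, n))
    (P : 'rV[R]_T) t x (pi : 'M[R]_n) :
  cost alpha ell u gamma P t x (row x pi) =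
  (ell t x (row x pi) + (gamma (now t) x +
     \sum_y pi x y * (alpha t x y * P 0 t + u (next t) y))%:E)%E.
Proof.
rewrite /cost -addeA -EFinD; congr (_ + (_ + _)%:E)%E.
by apply: eq_bigr => y _; rewrite mxE.
Qed.

(** With [l] a bound of the weighted running cost [m y], the right-hand side bounds [m]
    times the Bellman gap y + k - u. When [m = 0], [y] may be infinite, but [l] is
    still nonnegative. *)
Lemma weighted_gap_ge0 {R : realType} (m l k u : R) (y : \bar R) :
  0 <= m -> y != -oo%E -> (m%:E * y <= l%:E)%E -> (u%:E <= y + k%:E)%E ->
  0 <= l + m * (k - u).
Proof.
move=> m0; have [->|mN0] := eqVneq m 0.
  by rewrite mul0e mul0r addr0 lee_fin.
have {mN0}m_gt0 : 0 < m by rewrite lt_neqAle eq_sym mN0.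
case: y => [e||] // _; first by rewrite -EFinM -EFinD !lee_fin; nra.
by rewrite mulry gtr0_sg // mul1e leye_eq.
Qed.

Lemma weighted_gap_eq0 {R : realType} (m l k u : R) (y : \bar R) :
  0 < m -> y != -oo%E -> (m%:E * y <= l%:E)%E -> (u%:E <= y + k%:E)%E ->
  l + m * (k - u) = 0 -> (y + k%:E)%E = u%:E.
Proof.
move=> m_gt0; case: y => [e||] // _; last by rewrite mulry gtr0_sg // mul1e leye_eq.
rewrite -EFinM -EFinD !lee_fin => me ue l0; congr _%:E; apply/eqP.
by rewrite eq_le ue andbT -(ler_pM2l m_gt0); lra.
Qed.

(** * The mean field game *)

Theorem corollary5p4 (R : realType) (T n : nat)
    (T_ge1 : (1 <= T)%N) (n_ge1 : (1 <= n)%N)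
    (m0 : 'rV[R]_n) (alpha : 'I_T -> 'M[R]_n)
    (ell : 'I_T -> 'I_n -> 'rV[R]_n -> \bar R)
    (phi : 'I_T -> R^o -> \bar R)
    (F : 'I_T.+1 -> 'rV[R]_n -> \bar R)
    (m0_simplex : simplex m0)
    (standing : standing_assumption ell phi F)
    (qualified : qualification m0 alpha ell phi F) :
  exists (m : 'M[R]_(T.+1, n)) (pi : 'I_T -> 'M[R]_n)
         (u gamma : 'M[R]_(T.+1, n)) (P : 'rV[R]_T),
    MFG_solution m0 alpha ell phi F m pi u gamma P.
Proof.
have [ell_std F_std phi_std] := standing.
have ellNy t x v : ell t x v != -oo%E by have [[]] := ell_std t x.
have [m [pi [gamma [P [l [adm Fsub phisub lB opt]]]]]] :=
  multipliers_exist n_ge1 m0_simplex standing qualified.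
have [u [best [uT bestP]]] := bellman_exists alpha gamma P standing.
pose K (q : 'I_T -> 'M[R]_n) t x := gamma (now t) x +
  \sum_y q t x y * (alpha t x y * P 0 t + u (next t) y).
have u_le t x rho : ((u (now t) x)%:E <= cost alpha ell u gamma P t x rho)%E.
  by have [_ _] := bestP t x.
(* A Bellman-optimal policy and its flow [mb] compete with [pi] and [m] in the
   linearised problem. *)
have [mb [mb_flow _]] := perturbed_flow_exists_unique m0 0 best.
have adm_best : admissible m0 mb best.
  by apply: unperturbed_admissible => // t x; have [] := bestP t x.
have ell_best t x : ell t x (row x (best t)) = (u (now t) x - K best t x)%:E.
  have [_ + _] := bestP t x; rewrite cost_rowE -/(K best t x).
  case: (ell t x (row x (best t))) (ellNy t x (row x (best t))) => [e||] //= _.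
  by rewrite -EFinD => -[<-]; congr _%:E; ring.
have := opt mb best (fun t x => mb (now t) x * (u (now t) x - K best t x)) adm_best.
have /[swap]/[apply] : forall t x, ((mb (now t) x)%:E * ell t x (row x (best t)) <=
   (mb (now t) x * (u (now t) x - K best t x))%:E)%E.
  by move=> t x; rewrite ell_best EFinM.
rewrite -!addrA (telescoped_value _ _ adm uT) (telescoped_value _ _ adm_best uT).
rewrite ![_ + (\sum_x m0 0 x * u ord0 x + _)]addrCA lerD2l -!big_split /=.
under eq_bigr do rewrite -big_split /=.
under [leRHS]eq_bigr do rewrite -big_split /=.
rewrite [leRHS]big1 => [|t _]; last first.
  by apply: big1 => x _; rewrite -/(K best t x); ring.
have slack_ge0 t x : 0 <= l t x + m (now t) x * (K pi t x - u (now t) x).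
  apply: (weighted_gap_ge0 (admissible_ge0 _ _ adm) (ellNy _ _ _) (lB t x)).
  by rewrite -cost_rowE.
move=> slack_le0.
have slack0 t x : l t x + m (now t) x * (K pi t x - u (now t) x) = 0.
  apply/eqP; move: slack_le0.
  rewrite le_eqVlt ltNge sumr_ge0 ?orbF => [|t' _]; last first.
    by apply: sumr_ge0 => x' _; exact: slack_ge0.
  rewrite psumr_eq0 => [/allP /(_ t (mem_index_enum _)) /=|t' _]; last first.
    by apply: sumr_ge0 => x' _; exact: slack_ge0.
  rewrite psumr_eq0 => [/allP /(_ x (mem_index_enum _)) //|x' _].
  exact: slack_ge0.
have [spi sm flow init] := adm.
(* The policy is altered only where the flow puts no mass. *)
pose pi' t : 'M[R]_n :=
  \matrix_(x, y) (if m (now t) x == 0 then best t x y else pi t x y).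
have wE t x y : m (now t) x * pi' t x y = m (now t) x * pi t x y.
  by rewrite mxE; case: eqP => // ->; rewrite !mul0r.
have rowE t x : row x (pi' t) = if m (now t) x == 0 then row x (best t) else row x (pi t).
  by apply/rowP => y; case: ifP => mx0; rewrite !mxE mx0.
have costE t x : cost alpha ell u gamma P t x (row x (pi' t)) = (u (now t) x)%:E.
  rewrite rowE; case: eqP => [_|/eqP mN0]; first by have [] := bestP t x.
  have m_gt0 : 0 < m (now t) x by rewrite lt_neqAle eq_sym mN0 (admissible_ge0 _ _ adm).
  rewrite cost_rowE; apply: (weighted_gap_eq0 m_gt0 (ellNy _ _ _) (lB t x)) (slack0 t x).
  by rewrite -cost_rowE.
have spi' t x : simplex (row x (pi' t)).
  by rewrite rowE; case: eqP => _ //; have [] := bestP t x.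
have infE t x : ereal_inf [set cost alpha ell u gamma P t x rho | rho in simplex] =
    (u (now t) x)%:E.
  apply/eqP; rewrite eq_le; apply/andP; split.
    by apply: ereal_inf_lbound; exists (row x (pi' t)).
  by apply: le_ereal_inf_tmp => _ [rho _ <-].
exists m, pi', u, gamma, P; split=> //.
- by split=> // t x; rewrite infE.
- by move=> t x; split; rewrite // costE infE.
- by split=> // t x; rewrite flow; apply: eq_bigr => y _.
- move=> t; rewrite (_ : aggregate alpha m pi' t = aggregate alpha m pi t) //.
  by apply: eq_bigr => x _; apply: eq_bigr => y _; rewrite wE.
Qed.
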